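(* Let $X$ be a Bernoulli random variable with mean $\mu\in(0,1)$, let $\gamma$ be a positive integer, let $\delta\in(0,1)$ and $\theta=\frac{9}{2\ln\frac{2}{\delta}}$. Define $$\underline{\boldsymbol{\mu}}=\frac{\gamma}{\boldsymbol{n}}+\frac{3}{4+\boldsymbol{n}\theta}\left[1-\frac{2\gamma}{\boldsymbol{n}}-\sqrt{1+\theta\gamma\left(1-\frac{\gamma}{\boldsymbol{n}}\right)}\right],$$ $$\overline{\boldsymbol{\mu}}=\frac{\gamma}{\boldsymbol{n}}+\frac{3}{4+\boldsymbol{n}\theta}\left[1-\frac{2\gamma}{\boldsymbol{n}}+\sqrt{1+\theta\gamma\left(1-\frac{\gamma}{\boldsymbol{n}}\right)}\right].$$ Then $$\Pr\{\underline{\boldsymbol{\mu}}<\mu<\overline{\boldsymbol{\mu}}\}\ge 1-\delta.$$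
   Context: $X_1,X_2,\ldots$ are i.i.d. samples of the Bernoulli random variable $X$ (values in $\{0,1\}$, $\Pr\{X=1\}=\mu$). Inverse binomial sampling with threshold $\gamma$: sampling continues until the sample sum is no less than $\gamma$, and $\boldsymbol{n}$ is the (random) sample size at stopping, i.e. the smallest positive integer $n$ such that $\sum_{i=1}^{n}X_i\ge\gamma$ (it is finite almost surely, and $\boldsymbol{n}\ge\gamma$). *)

(* Defs.v *)
From HB Require Import structures.
From mathcomp Require Import all_boot all_order all_algebra finmap.
From mathcomp Require Import all_classical all_reals all_analysis.

Set Implicit Arguments.
Unset Strict Implicit.
Unset Printing Implicit Defensive.

Import Order.TTheory GRing.Theory Num.Theory.
Import numFieldNormedType.Exports.

Local Open Scope classical_set_scope.
Local Open Scope ring_scope.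

Definition mutually_independent d d' (T : measurableType d)
    (T' : measurableType d') (R : realType) (P : probability T R)
    (I : choiceType) (X : I -> {RV P >-> T'}) : Prop :=
  forall (J : {fset I}) (A : I -> set T'),
    (forall i, i \in J -> measurable (A i)) ->
    P (\bigcap_(i in [set` J]) (X i @^-1` A i)) =
    (\prod_(i <- J) P (X i @^-1` A i))%E.

Arguments mutually_independent {d d' T T' R} P {I} X.

(* Booleans stand for {0, 1}: [true] is 1 and [false] is 0.  The sequence is
   indexed from 0, so that [X i] is the (i+1)-th sample. *)
Definition iid_bernoulli d (T : measurableType d) (R : realType)
    (P : probability T R) (mu : R) (X : nat -> {RV P >-> bool}) : Prop :=
  mutually_independent P X /\
  forall i, distribution P (X i) =1 bernoulli_prob mu.

Arguments iid_bernoulli {d T R} P mu X.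

Definition sample_sum (x : nat -> bool) (n : nat) : nat :=
  (\sum_(i < n) x i)%N.

Definition is_stopping_size (gamma : nat) (x : nat -> bool) (n : nat) : Prop :=
  [/\ (0 < n)%N, (gamma <= sample_sum x n)%N &
      forall m, (0 < m)%N -> (gamma <= sample_sum x m)%N -> (n <= m)%N].

(* The sample size of inverse binomial sampling with threshold [gamma] on the
   outcomes [x].  The default value 0 is taken only when the threshold is never
   reached, an event of probability zero for i.i.d. samples of positive mean. *)
Definition stopping_size (gamma : nat) (x : nat -> bool) : nat :=
  xget 0%N [set n | is_stopping_size gamma x n].

Definition ci_lower (R : realType) (theta : R) (gamma n : nat) : R :=
  gamma%:R / n%:R +
  3 / (4 + n%:R * theta) *
  (1 - 2 * gamma%:R / n%:R -
   Num.sqrt (1 + theta * gamma%:R * (1 - gamma%:R / n%:R))).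

Definition ci_upper (R : realType) (theta : R) (gamma n : nat) : R :=
  gamma%:R / n%:R +
  3 / (4 + n%:R * theta) *
  (1 - 2 * gamma%:R / n%:R +
   Num.sqrt (1 + theta * gamma%:R * (1 - gamma%:R / n%:R))).

(* Main.v *)
Require Import Defs.
From HB Require Import structures.
From mathcomp Require Import all_boot all_order all_algebra finmap.
From mathcomp Require Import all_classical all_reals all_analysis.
From mathcomp Require Import ring lra zify.

Set Implicit Arguments.
Unset Strict Implicit.
Unset Printing Implicit Defensive.

Import Order.TTheory GRing.Theory Num.Theory.
Import numFieldNormedType.Exports.

Local Open Scope classical_set_scope.
Local Open Scope ring_scope.

(* Put z = gamma / n and let Q(mu) be the quadratic
   n theta (z - mu)^2 - (2 mu + z)(3 - 2 mu - z).  The two confidence limits are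
   the roots of Q, so coverage fails only at sample sizes n with Q(mu) >= 0.
   By Massart's lower bound on the Kullback-Leibler divergence, at such an n the
   likelihood ratio (z/mu)^gamma ((1-z)/(1-mu))^(n-gamma) is at least 2/delta.
   Let n1 be the largest such n with z > mu, and n2 the smallest with z < mu.
   Failure forces either n <= n1, i.e. S_{n1} >= gamma, or n >= n2, i.e.
   S_{n2 - 1} < gamma (which also contains the runs that never stop).  Each of these two events about a fixed number of samples
   has probability at most delta / 2 by a change of measure with that likelihood
   ratio; no monotonicity of Q in n is needed. *)

(** * Calculus: Massart's lower bound on the Kullback-Leibler divergence *)

(** Mean value theorem on the segment joining [z] and [x], in either order. The condition
    [(t - z) * (t - x) <= 0] confines the sign check to that segment; in the uses below
    [f z = 0]. *)
Lemma le_of_derive_sign (R : realType) (f df : R -> R) (a b z x : R) :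
  (forall t, a < t < b -> is_derive t 1 f (df t)) ->
  (forall t, a < t < b -> (t - z) * (t - x) <= 0 -> 0 <= (t - z) * df t) ->
  a < z < b -> a < x < b -> f z <= f x.
Proof.
move=> dF sgn /andP[az zb] /andP[ax xb].
have [u [v [uv au vb Huv]]] : exists u v, [/\ u <= v, a < u, v < b &
    (u = z /\ v = x) \/ (u = x /\ v = z)].
  have [zx|xz] := leP z x; [exists z, x|exists x, z]; split; rewrite ?(ltW xz) //; tauto.
have inab (t : R) : t \in `[u, v] -> a < t < b.
  by rewrite in_itv/= => /andP[ut tv]; rewrite (lt_le_trans au ut) (le_lt_trans tv vb).
have [uv'|] := ltP u v; last first.
  move=> vu; have : u = v by apply/eqP; rewrite eq_le uv vu.
  by case: Huv => -[<- <-] ->.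
have [||c cuv E] := @MVT R f df u v uv'.
- by move=> t tuv; apply/dF/inab/subset_itv_oo_cc.
- apply: derivable_within_continuous => t /inab/dF dt.
  exact: ex_derive.
have s := sgn _ (inab _ (subset_itv_oo_cc cuv)).
move: cuv; rewrite in_itv/= => /andP[uc cv].
case: Huv => -[? ?]; subst u v.
- have {}s : 0 <= (c - z) * df c by apply: s; nra.
  rewrite -subr_ge0 E pmulr_lge0 ?subr_gt0 //.
  by rewrite pmulr_rge0 ?subr_gt0 // in s.
- have {}s : 0 <= (c - z) * df c by apply: s; nra.
  rewrite -subr_le0 E pmulr_lle0 ?subr_gt0 //.
  by rewrite nmulr_rge0 ?subr_lt0 // in s.
Qed.

(* For fixed z the difference of the two sides, as a function of the mean x,
   vanishes at z and has a rational derivative with the sign of x - z. *)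
Lemma kl_ge_massart_lt1 (R : realType) (z x : R) : 0 < z < 1 -> 0 < x < 1 ->
  9 * (z - x) ^+ 2 / (2 * ((2 * x + z) * (3 - 2 * x - z))) <=
  z * ln (z / x) + (1 - z) * ln ((1 - z) / (1 - x)).
Proof.
move=> z01 x01; have /andP[z0 z1] := z01; have /andP[x0 x1] := x01.
pose D (t : R) := (2 * t + z) * (3 - 2 * t - z).
pose f (t : R) := - (z * ln t) - (1 - z) * ln (1 - t) -
  9 / 2 * ((z - t) ^+ 2 * (D t)^-1).
pose df (t : R) := (t - z) / (t * (1 - t)) -
  9 / 2 * (2 * (t - z) / D t - (t - z) ^+ 2 * (6 - 8 * t - 4 * z) / (D t) ^+ 2).
have D0 (t : R) : 0 < t < 1 -> 0 < D t.
  by move=> /andP[t0 t1]; apply: mulr_gt0; lra.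
have dF (t : R) : 0 < t < 1 -> is_derive t 1 f (df t).
  move=> t01; have Dt := D0 _ t01; have /andP[t0 t1] := t01.
  have dl := is_derive1_ln t0.
  have t1' : 0 < 1 - t by lra.
  have dl1 : is_derive t 1 (fun t : R => ln (1 - t)) (- (1 - t)^-1).
    have d1 : is_derive t 1 (fun t : R => 1 - t) (-1).
      apply: is_derive_eq. rewrite /GRing.scale/=; ring.
    have := @is_derive1_comp R (@ln R) (fun t => 1 - t) t _ _ (is_derive1_ln t1') d1.
    by rewrite mulrN1.
  have dD : is_derive t 1 D (6 - 8 * t - 4 * z).
    apply: is_derive_eq.
    rewrite /GRing.scale/=. ring.
  have dDV := is_deriveV (lt0r_neq0 Dt) dD.
  apply: is_derive_eq.
  rewrite /GRing.scale/= /df.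
  move: (D t) Dt => Dt Dt0; field.
  by rewrite !lt0r_neq0.
have sgn (t : R) : 0 < t < 1 -> (t - z) * (t - x) <= 0 -> 0 <= (t - z) * df t.
  move=> t01 _; have Dt := D0 _ t01; have /andP[t0 t1] := t01.
  (* [y] lies a third of the way from [t] to [z], and [D t = 9 y (1 - y)]. In terms of [y] the
     numerator is a fourth power times a combination of squares with weights [1 - t] and [t]. *)
  pose y := (2 * t + z) / 3.
  have -> : (t - z) * df t = 9 * (t - z) ^+ 4 *
      ((1 - t) * (1 - y) ^+ 2 + t * y ^+ 2) / (t * (1 - t) * (D t) ^+ 2).
    rewrite /df /y /D; field.
    by repeat (apply/andP; split); rewrite lt0r_neq0 //; lra.
  apply: divr_ge0; last by rewrite !mulr_ge0 ?sqr_ge0 //; lra.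
  apply: mulr_ge0; first by rewrite mulr_ge0 // (exprM _ 2 2) sqr_ge0.
  by apply: addr_ge0; apply: mulr_ge0; rewrite ?sqr_ge0 //; lra.
have := le_of_derive_sign dF sgn z01 x01.
rewrite /f subrr expr0n mul0r mulr0 subr0.
rewrite !ln_div ?posrE ?subr_gt0 //.
have -> : 9 * (z - x) ^+ 2 / (2 * ((2 * x + z) * (3 - 2 * x - z))) =
  9 / 2 * ((z - x) ^+ 2 / D x).
  have := D0 _ x01; rewrite /D => Dx. rewrite invfM. ring.
lra.
Qed.

(** The endpoint [z = 1] of the divergence bound, after cancelling a factor [1 - x]. *)
Lemma ln_ge_massart (R : realType) (x : R) : 0 < x < 1 ->
  9 * (1 - x) / (4 * (2 * x + 1)) <= - ln x.
Proof.
move=> /andP[x0 x1].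
pose f (t : R) := - ln t - 9 / 4 * ((1 - t) * (2 * t + 1)^-1).
pose df (t : R) := - t^-1 + 27 / 4 * ((2 * t + 1) ^+ 2)^-1.
(* The interval reaches up to 2 so that the base point 1 is interior; the sign of [df] is examined
   only for [t <= 1]. *)
have dF (t : R) : 0 < t < 2 -> is_derive t 1 f (df t).
  move=> /andP[t0 _].
  have t21 : 2 * t + 1 != 0 by rewrite lt0r_neq0 //; lra.
  have dl := is_derive1_ln t0.
  have dD : is_derive t 1 (fun t : R => 2 * t + 1) 2.
    by apply: is_derive_eq; rewrite /GRing.scale/=; ring.
  have dDV := @is_deriveV R (fun t => 2 * t + 1) t _ _ t21 dD.
  apply: is_derive_eq; rewrite /GRing.scale/= /df; field.
  by rewrite t21 lt0r_neq0.
have sgn (t : R) : 0 < t < 2 -> (t - 1) * (t - x) <= 0 -> 0 <= (t - 1) * df t.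
  move=> /andP[t0 _] tx.
  have t1 : t <= 1 by rewrite leNgt; apply/negP => t1; nra.
  (* The quadratic factor is positive: its discriminant is 121 - 256. *)
  have -> : (t - 1) * df t =
      (1 - t) * (16 * t ^+ 2 - 11 * t + 4) / (4 * (t * (2 * t + 1) ^+ 2)).
    rewrite /df; field; by apply/andP; split; rewrite lt0r_neq0 //; lra.
  apply: divr_ge0.
    by apply: mulr_ge0; nra.
  by rewrite mulr_ge0 // mulr_ge0 ?sqr_ge0 // ltW.
have := @le_of_derive_sign _ f df 0 2 1 x dF sgn.
have -> : f 1 = 0 by rewrite /f ln1 subrr mul0r mulr0 oppr0 addr0.
rewrite ltr01 ltr1n x0 (lt_trans x1) ?ltr1n // => /(_ isT isT); rewrite /f.
have -> : 9 * (1 - x) / (4 * (2 * x + 1)) = 9 / 4 * ((1 - x) * (2 * x + 1)^-1).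
  by rewrite invfM; ring.
lra.
Qed.

(* At z = 1 the second summand is the junk value 0 * ln 0 = 0, as it should. *)
Lemma kl_ge_massart (R : realType) (z x : R) : 0 < z <= 1 -> 0 < x < 1 ->
  9 * (z - x) ^+ 2 / (2 * ((2 * x + z) * (3 - 2 * x - z))) <=
  z * ln (z / x) + (1 - z) * ln ((1 - z) / (1 - x)).
Proof.
move=> /andP[z0]; rewrite le_eqVlt => /orP[/eqP-> x01|z1 x01]; last first.
  by apply: kl_ge_massart_lt1; rewrite ?z0.
have /andP[x0 x1] := x01.
rewrite subrr !mul0r addr0 mul1r ln_div ?posrE // ln1 sub0r.
apply: le_trans (ln_ge_massart x01); rewrite le_eqVlt; apply/orP; left; apply/eqP.
field; by rewrite !lt0r_neq0 //; lra.
Qed.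

(** The right-hand side is the exponential of [n] times the divergence. The constant in [theta] is
    the one for which the last hypothesis says that [n] times Massart's bound is at least
    [ln (2 / delta)]. *)
Lemma tilt_ge (R : realType) (mu delta : R) (gamma n : nat) :
  let theta := 9 / (2 * ln (2 / delta)) in
  let z := gamma%:R / n%:R in
  0 < mu < 1 -> 0 < delta < 1 -> (0 < gamma <= n)%N ->
  (2 * mu + z) * (3 - 2 * mu - z) <= n%:R * theta * (z - mu) ^+ 2 ->
  2 / delta <= (z / mu) ^+ gamma * ((1 - z) / (1 - mu)) ^+ (n - gamma).
Proof.
move=> theta z mu01 /andP[d0 d1] /andP[g0 gn] bad.
have /andP[mu0 mu1] := mu01.
have n0 : 0 < n%:R :> R by rewrite ltr0n (leq_trans g0 gn).
have z0 : 0 < z by apply: divr_gt0 => //; rewrite ltr0n.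
have z1 : z <= 1 by rewrite ler_pdivrMr // mul1r ler_nat.
have gE : gamma%:R = n%:R * z :> R by rewrite /z mulrC divfK ?lt0r_neq0.
have zlt : (gamma < n)%N -> z < 1.
  by move=> ng; rewrite ltr_pdivrMr // mul1r ltr_nat.
have zeq : gamma = n -> z = 1.
  by move=> e; rewrite /z e divff ?lt0r_neq0.
clearbody z.
have dd : 1 < 2 / delta by rewrite ltr_pdivlMr //; lra.
have L0 : 0 < ln (2 / delta) by exact: ln_gt0.
have D0 : 0 < (2 * mu + z) * (3 - 2 * mu - z) by apply: mulr_gt0; lra.
have zmu : 0 < z / mu by exact: divr_gt0.
have -> : (z / mu) ^+ gamma * ((1 - z) / (1 - mu)) ^+ (n - gamma) =
    expR (n%:R * (z * ln (z / mu) + (1 - z) * ln ((1 - z) / (1 - mu)))).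
  rewrite mulrDr expRD !mulrA -gE expRM_natl lnK ?posrE //; congr (_ * _).
  (* If [gamma = n], then [1 - z = 0]: the default value of [ln 0] is multiplied by 0, and the power
     is [0 ^+ 0 = 1], so both sides are 1. *)
  have [ng|ng] := ltnP gamma n; last first.
    have e : gamma = n by apply/eqP; rewrite eqn_leq gn ng.
    by rewrite (zeq e) e subnn subrr !mulr0 mul0r expR0.
  have z1' := zlt ng.
  have -> : n%:R * (1 - z) = (n - gamma)%:R by rewrite natrB // gE; ring.
  by rewrite expRM_natl lnK ?posrE // divr_gt0 ?subr_gt0.
rewrite -[leLHS]lnK ?posrE; last by apply: lt_trans dd.
rewrite ler_expR.
have := @kl_ge_massart R z mu; rewrite z0 z1 => /(_ isT mu01).
rewrite ler_pdivrMr; last lra.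
move: bad; rewrite /theta.
have -> : n%:R * (9 / (2 * ln (2 / delta))) * (z - mu) ^+ 2 =
  n%:R * (9 * (z - mu) ^+ 2) / (2 * ln (2 / delta)).
  by rewrite invfM; ring.
rewrite ler_pdivlMr; last lra.
move: D0 L0 n0; set K := z * _ + _; set D := (2 * mu + z) * (3 - 2 * mu - z).
set L := ln _; set e := 9 * _; set N := n%:R => D0 L0 n0 h1 h2.
have h3 : N * e <= N * (K * (2 * D)) by rewrite ler_pM2l.
rewrite -(ler_pM2l D0); lra.
Qed.

(** * Law of finitely many samples and a weighted Markov inequality *)

Section Bernoulli.
Context (R : realType) d (T : measurableType d) (P : probability T R)
  (mu : R) (X : nat -> {RV P >-> bool}).

Lemma measurable_RV_eq i b : measurable [set w | X i w = b].
Proof.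
have -> : [set w | X i w = b] = X i @^-1` [set b] by [].
rewrite -[_ @^-1` _]setTI; exact: measurable_funP.
Qed.

Lemma measurable_pattern m (f : 'I_m -> bool) :
  measurable [set w | forall i : 'I_m, X i w = f i].
Proof.
have -> : [set w | forall i : 'I_m, X i w = f i] =
    \bigcap_(i in [set: 'I_m]) [set w | X i w = f i].
  by apply/seteqP; split => w /= h i; [move=> _; exact: h|exact: h].
apply: fin_bigcap_measurable; first exact: finite_finset.
by move=> i _; exact: measurable_RV_eq.
Qed.

(** Reduces events on the sum to a finite union of outcome patterns, for measurability as well as
    for the probability bound. *)
Lemma sample_sum_event m (Q : pred nat) :
  [set w | Q (sample_sum (X^~ w) m)] =
  \bigcup_(f in [set f : {ffun 'I_m -> bool} | Q (\sum_i f i)%N])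
    [set w | forall i : 'I_m, X i w = f i].
Proof.
apply/seteqP; split => w /=.
- move=> q; exists [ffun i : 'I_m => X i w] => /=; last by move=> i; rewrite ffunE.
  rewrite (eq_bigr (fun i : 'I_m => X i w : nat)) // => i _; by rewrite ffunE.
- move=> [f /= q h]; rewrite /sample_sum (eq_bigr (fun i => f i : nat)) // => i _.
  by rewrite h.
Qed.

Lemma measurable_sample_sum m (Q : pred nat) :
  measurable [set w | Q (sample_sum (X^~ w) m)].
Proof.
rewrite sample_sum_event; apply: fin_bigcup_measurable => [|f _].
  exact: finite_finset.
exact: measurable_pattern.
Qed.

Hypotheses (mu01 : 0 < mu < 1) (iidX : iid_bernoulli P mu X).

Lemma probability_pattern m (f : 'I_m -> bool) :
  P [set w | forall i : 'I_m, X i w = f i] =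
  (\prod_i bernoulli_pmf mu (f i))%:E.
Proof.
have /andP[mu0 mu1] := mu01; have [ind dist] := iidX.
(* Independence concerns families indexed by [nat], so [f] is extended beyond [m] by an arbitrary
   value. *)
pose g (i : nat) := if insub i is Some j then f j else false.
have gE (i : 'I_m) : g i = f i by rewrite /g valK.
have := ind [fset i in iota 0 m]%fset (fun i => [set g i]) (fun i _ => I).
have -> : \bigcap_(i in [set` [fset i in iota 0 m]%fset]) (X i @^-1` [set g i])
  = [set w | forall i : 'I_m, X i w = f i].
  apply/seteqP; split => w /= h.
  - move=> i; rewrite -gE; apply: h; rewrite /= !inE mem_iota/= add0n; exact: ltn_ord.
  - move=> i; rewrite /= !inE mem_iota/= add0n => im.
    by rewrite (h (Ordinal im)) -gE.
move=> ->.
rewrite (perm_big (iota 0 m)); last first.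
  apply: uniq_perm; rewrite ?iota_uniq ?fset_uniq // => i; by rewrite !inE.
rewrite -{1}[m]subn0 -/(index_iota 0 m) big_mkord -prodEFin.
apply: eq_bigr => i _.
have -> : P (X i @^-1` [set g i]) = distribution P (X i) [set g i] by [].
have setE (b c : bool) : (b \in [set c]) = (b == c).
  by apply/idP/eqP; rewrite inE.
rewrite dist bernoulli_probE ?(ltW mu0) ?(ltW mu1) // gE !diracE !setE.
by case: (f i); rewrite /= ?mule1 ?mule0 ?adde0 ?add0e.
Qed.

(* Markov's inequality for [u^S v^(m-S)], with [S] the sample sum; using two
   weights instead of one exponential parameter covers the case [v = 0]. *)
Lemma sample_sum_weight_bound m (Q : pred nat) (u v c : R) :
  0 <= u -> 0 <= v -> 0 <= c ->
  (forall k, (k <= m)%N -> Q k -> c <= u ^+ k * v ^+ (m - k)) ->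
  (c%:E * P [set w | Q (sample_sum (X^~ w) m)] <=
   ((mu * u + (1 - mu) * v) ^+ m)%:E)%E.
Proof.
move=> u0 v0 c0 cQ; have /andP[mu0 mu1] := mu01.
pose wt (b : bool) := if b then u else v.
have pge b : 0 <= bernoulli_pmf mu b by case: b; rewrite /= ?subr_ge0 ltW.
have wge b : 0 <= wt b by case: b.
(* Finite subadditivity over the patterns gives the direction wanted. *)
have ub : (P [set w | Q (sample_sum (X^~ w) m)] <=
    (\sum_(f : {ffun 'I_m -> bool} | Q (\sum_i f i)%N)
      \prod_i bernoulli_pmf mu (f i))%:E)%E.
  have := @content_sub_fsum _ _ _ P _
    [set f : {ffun 'I_m -> bool} | Q (\sum_i f i)%N] _
    (fun f => [set w | forall i : 'I_m, X i w = f i])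
    finite_finset (fun f _ => measurable_pattern f)
    (measurable_sample_sum m Q).
  rewrite -sample_sum_event => /(_ (@subset_refl _ _)).
  move=> h; apply: (le_trans h).
  rewrite (fsbigE [seq f : {ffun 'I_m -> bool} <-
    index_enum {ffun 'I_m -> bool} | Q (\sum_i f i)%N]).
  - rewrite big_filter_cond -sumEFin big_mkcondr /=.
    apply: lee_sum => f Qf; rewrite mem_set //; by rewrite probability_pattern.
  - by rewrite filter_uniq // index_enum_uniq.
  - by move=> f /=; rewrite mem_filter => /andP[].
  - by move=> f /= Qf; rewrite mem_filter mem_index_enum Qf.
apply: le_trans (lee_wpmul2l _ ub) _; first by rewrite lee_fin.
rewrite -EFinM lee_fin big_distrr /=.
(* Expanding the power gives one term per pattern; those violating [Q] are nonnegative and will be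
   dropped. *)
have -> : (mu * u + (1 - mu) * v) ^+ m =
    \sum_(f : {ffun 'I_m -> bool}) \prod_i (bernoulli_pmf mu (f i) * wt (f i)).
  rewrite -(bigA_distr_bigA (fun _ b => bernoulli_pmf mu b * wt b)) /=.
  by rewrite prodr_const card_ord big_bool.
rewrite [leRHS](bigID (fun f : {ffun 'I_m -> bool} => Q (\sum_i f i)%N)) /=.
rewrite -[leLHS]addr0; apply: lerD; last first.
  by apply: sumr_ge0 => f _; apply: prodr_ge0 => i _; exact: mulr_ge0.
apply: ler_sum => f Qf.
rewrite big_split /= mulrC; apply: ler_wpM2l; first exact: prodr_ge0.
have -> : \prod_i wt (f i) = u ^+ (\sum_i f i)%N * v ^+ (m - \sum_i f i)%N.
  have -> : (m - \sum_i f i = \sum_i ~~ f i)%N.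
    rewrite -[X in (X - _)%N](card_ord m) -sum1_card -sumnB => [|i _]; last exact: leq_b1.
    by apply: eq_bigr => i _; case: (f i).
  rewrite !expr_sum -big_split /=; apply: eq_bigr => i _.
  by case: (f i); rewrite /= ?mulr1 ?mul1r.
apply: cQ => //.
rewrite -[leqRHS](card_ord m) -sum1_card; apply: leq_sum => i _; exact: leq_b1.
Qed.
End Bernoulli.

(** * Tail bounds for a fixed sample size by change of measure *)

Lemma tail_le_of_weight (R : realType) d (T : measurableType d)
    (P : probability T R) (A : set T) (c b : R) :
  measurable A -> 0 < b -> b^-1 <= c -> (c%:E * P A <= 1)%E -> (P A <= b%:E)%E.
Proof.
move=> mA b0 bc; have /fineK <- := fin_num_measure P A mA.
have p0 : 0 <= fine (P A) by apply: fine_ge0.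
rewrite -EFinM !lee_fin => h; rewrite -[leRHS]mulr1 -ler_pdivrMl //.
by apply: le_trans h; rewrite ler_wpM2r.
Qed.

(** Trading factors [v <= 1] for factors [u >= 1] can only increase the weight, so its value at the
    threshold bounds it below on the whole upper tail. *)
Lemma weight_le_up (R : numDomainType) (u v : R) (a k n : nat) :
  1 <= u -> 0 <= v <= 1 -> (a <= k <= n)%N ->
  u ^+ a * v ^+ (n - a) <= u ^+ k * v ^+ (n - k).
Proof.
move=> u1 /andP[v0 v1] /andP[ak kn]; have u0 : 0 <= u by exact: le_trans u1.
have -> : (n - a = n - k + (k - a))%N by lia.
rewrite -[X in _ <= _ ^+ X * _](subnKC ak) !exprD -mulrA.
apply: ler_wpM2l; first exact: exprn_ge0.
rewrite mulrC; apply: ler_wpM2r; first exact: exprn_ge0.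
by apply: (@le_trans _ _ 1); rewrite ?exprn_ile1 ?exprn_ege1.
Qed.

(** From left to right one factor [u <= 1] is dropped, which accounts for the lost sample, and the
    other [a.-1 - k] excess factors [u] become [v >= 1]. *)
Lemma weight_le_down (R : numDomainType) (u v : R) (a k n : nat) :
  0 <= u <= 1 -> 1 <= v -> (k < a <= n)%N ->
  u ^+ a * v ^+ (n - a) <= u ^+ k * v ^+ (n.-1 - k).
Proof.
move=> /andP[u0 u1] v1 /andP[ka an]; have v0 : 0 <= v by exact: le_trans v1.
have -> : (n.-1 - k = n - a + (a.-1 - k))%N by lia.
rewrite -[X in _ ^+ X * _ <= _](subnKC (ltnW ka)) !exprD -mulrA.
apply: ler_wpM2l; first exact: exprn_ge0.
rewrite mulrC; apply: ler_wpM2l; first exact: exprn_ge0.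
by apply: (@le_trans _ _ 1); rewrite ?exprn_ile1 ?exprn_ege1.
Qed.

Section Tails.
Context (R : realType) d (T : measurableType d) (P : probability T R)
  (mu : R) (X : nat -> {RV P >-> bool}) (gamma n : nat) (delta : R).
Let theta := 9 / (2 * ln (2 / delta)).
Let z : R := gamma%:R / n%:R.
Hypotheses (mu01 : 0 < mu < 1) (iidX : iid_bernoulli P mu X).
Hypotheses (delta01 : 0 < delta < 1) (gn : (0 < gamma <= n)%N).
Hypothesis bad :
  (2 * mu + z) * (3 - 2 * mu - z) <= n%:R * theta * (z - mu) ^+ 2.

(** The weights are the one-sample likelihood ratios of mean [z] against mean [mu], so their
    expectation is [z + (1 - z)]. Markov's bound thus becomes 1 for every number of samples. *)
Let tilt_mean : mu * (z / mu) + (1 - mu) * ((1 - z) / (1 - mu)) = 1.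
Proof. by have /andP[mu0 mu1] := mu01; field; rewrite !lt0r_neq0 ?subr_gt0. Qed.

Let z01 : 0 <= z <= 1.
Proof.
have /andP[g0 gn'] := gn.
have n0 : 0 < n%:R :> R by rewrite ltr0n (leq_trans g0 gn').
by rewrite divr_ge0 //= ler_pdivrMr // mul1r ler_nat.
Qed.

Let tilt_weights : 0 <= z / mu /\ 0 <= (1 - z) / (1 - mu).
Proof.
have /andP[mu0 mu1] := mu01; have /andP[z0 z1] := z01.
by split; apply: divr_ge0; rewrite ?subr_ge0 // ltW.
Qed.

Lemma upper_tail_le : mu <= z ->
  (P [set w | (gamma <= sample_sum (X^~ w) n)%N] <= (delta / 2)%:E)%E.
Proof.
move=> muz; have /andP[mu0 mu1] := mu01; have [u0 v0] := tilt_weights.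
have c2 := tilt_ge mu01 delta01 gn bad; have /andP[d0 d1] := delta01.
have /andP[z0 z1] := z01; have /andP[_ gn'] := gn.
have u1 : 1 <= z / mu by rewrite ler_pdivlMr // mul1r.
have v1 : (1 - z) / (1 - mu) <= 1 by rewrite ler_pdivrMr ?subr_gt0 //; lra.
apply: (tail_le_of_weight (measurable_sample_sum X n (leq gamma)) _ _ _).
- exact: divr_gt0.
- by rewrite invf_div; exact: c2.
apply: (@le_trans _ _ ((mu * (z / mu) + (1 - mu) * ((1 - z) / (1 - mu))) ^+ n)%:E);
  last by rewrite tilt_mean expr1n.
apply: (sample_sum_weight_bound mu01 iidX (Q := leq gamma)) => // [|k kn gk].
  by rewrite mulr_ge0 ?exprn_ge0.
by apply: weight_le_up => //; apply/andP; split.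
Qed.

Lemma lower_tail_le : z <= mu ->
  (P [set w | (sample_sum (X^~ w) n.-1 < gamma)%N] <= (delta / 2)%:E)%E.
Proof.
move=> zmu; have /andP[mu0 mu1] := mu01; have [u0 v0] := tilt_weights.
have c2 := tilt_ge mu01 delta01 gn bad; have /andP[d0 d1] := delta01.
have /andP[z0 z1] := z01; have /andP[g0 gn'] := gn.
have u1 : z / mu <= 1 by rewrite ler_pdivrMr // mul1r.
have v1 : 1 <= (1 - z) / (1 - mu) by rewrite ler_pdivlMr ?subr_gt0 //; lra.
apply: (tail_le_of_weight (measurable_sample_sum X n.-1 (ltn^~ gamma)) _ _ _).
- exact: divr_gt0.
- by rewrite invf_div; exact: c2.
apply: (@le_trans _ _ ((mu * (z / mu) + (1 - mu) * ((1 - z) / (1 - mu))) ^+ n.-1)%:E);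
  last by rewrite tilt_mean expr1n.
apply: (sample_sum_weight_bound mu01 iidX (Q := ltn^~ gamma)) => // [|k kn kg].
  by rewrite mulr_ge0 ?exprn_ge0.
by apply: weight_le_down => //; apply/andP; split.
Qed.
End Tails.

(** * Sample sums and the stopping size *)

Lemma sample_sumS x n : sample_sum x n.+1 = (sample_sum x n + x n)%N.
Proof. by rewrite /sample_sum big_ord_recr. Qed.

Lemma sample_sum0 x : sample_sum x 0 = 0%N.
Proof. by rewrite /sample_sum big_ord0. Qed.

Lemma sample_sum_homo x : {homo sample_sum x : m n / (m <= n)%N}.
Proof.
by apply: homo_leq leq_trans _ => // n; rewrite sample_sumS leq_addr.
Qed.

Lemma sample_sum_le x n : (sample_sum x n <= n)%N.
Proof.
rewrite -[leqRHS](card_ord n) -sum1_card; apply: leq_sum => i _; exact: leq_b1.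
Qed.

(** Any [m] reaching the threshold shows that the default 0 is not taken. *)
Lemma stopping_size_spec (gamma m : nat) x : (0 < gamma)%N ->
  (gamma <= sample_sum x m)%N -> is_stopping_size gamma x (stopping_size gamma x).
Proof.
move=> g0 gm; apply: xgetPex.
have m0 : (0 < m)%N by case: m gm => //; rewrite sample_sum0 leqNgt g0.
have ex : exists k, (0 < k)%N && (gamma <= sample_sum x k)%N by exists m; rewrite m0.
case: (ex_minnP ex) => k /andP[k0 gk] kmin.
by exists k; split => // j j0 gj; apply: kmin; rewrite j0.
Qed.

(** Expresses each genuine stopping value, necessarily positive, by two sums of fixed length;
    measurability follows from this. *)
Lemma stopping_sizeS (gamma k : nat) x : (0 < gamma)%N ->
  stopping_size gamma x = k.+1 <->
  (gamma <= sample_sum x k.+1)%N /\ (sample_sum x k < gamma)%N.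
Proof.
move=> g0; split => [|[gk1 kg]].
- move=> nk.
  have [_ gn nmin] : is_stopping_size gamma x k.+1.
    by move: nk; rewrite /stopping_size; case: xgetP => // n _ sn <-.
  split=> //; rewrite ltnNge; apply/negP; case: k {nk} gn nmin => [|k] _ nmin gk.
    by move: gk; rewrite sample_sum0 leqNgt g0.
  by have := nmin _ (ltn0Sn k) gk; rewrite ltnn.
- have [n0 gn nmin] := stopping_size_spec g0 gk1.
  apply/eqP; rewrite eqn_leq nmin //= ltnNge; apply/negP => nk.
  by have := leq_trans gn (sample_sum_homo x nk); rewrite leqNgt kg.
Qed.

Lemma measurable_stopping_size (R : realType) d (T : measurableType d)
    (P : probability T R) (X : nat -> {RV P >-> bool}) (gamma : nat)
    (A : set nat) : (0 < gamma)%N ->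
  measurable [set w | A (stopping_size gamma (X^~ w))].
Proof.
move=> g0.
pose N w := stopping_size gamma (X^~ w).
have mS k : measurable [set w | N w = k.+1].
  have -> : [set w | N w = k.+1] =
      [set w | (gamma <= sample_sum (X^~ w) k.+1)%N] `&`
      [set w | (sample_sum (X^~ w) k < gamma)%N].
    by apply/seteqP; split => w; rewrite /N /= stopping_sizeS.
  apply: measurableI; first exact: (measurable_sample_sum X _ (leq gamma)).
  exact: (measurable_sample_sum X _ (ltn^~ gamma)).
have mk k : measurable [set w | N w = k].
  case: k => //.
  (* The value 0 marks the runs that never stop, the complement of all the positive values. *)
  have -> : [set w | N w = 0%N] = ~` \bigcup_k [set w | N w = k.+1].
    apply/seteqP; split => [w /= N0 [k _ /=]|w /= h]; first by rewrite N0.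
    by case e : (N w) => [//|k]; exfalso; apply: h; exists k.
  by apply: measurableC; apply: bigcup_measurable.
have -> : [set w | A (stopping_size gamma (X^~ w))] =
    \bigcup_(k in A) [set w | N w = k].
  apply/seteqP; split => [w /= Aw|w [k Ak /= Nk]]; first by exists (N w).
  by rewrite -/(N w) Nk.
by apply: bigcup_measurable.
Qed.

(** * From the quadratic to the confidence limits and the two cutoffs *)

Lemma ci_of_quadratic (R : realType) (theta mu : R) (gamma n : nat) :
  let z := gamma%:R / n%:R in
  0 < theta -> (0 < gamma <= n)%N ->
  n%:R * theta * (z - mu) ^+ 2 < (2 * mu + z) * (3 - 2 * mu - z) ->
  ci_lower theta gamma n < mu < ci_upper theta gamma n.
Proof.
move=> z th0 /andP[g0 gn] good.
have n0 : 0 < n%:R :> R by rewrite ltr0n (leq_trans g0 gn).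
have z0 : 0 <= z by rewrite divr_ge0.
have z1 : z <= 1 by rewrite ler_pdivrMr // mul1r ler_nat.
have gE : gamma%:R = n%:R * z :> R by rewrite /z mulrC divfK ?lt0r_neq0.
rewrite /ci_lower /ci_upper -[2 * _ / _]mulrA -/z gE.
clearbody z; move: n%:R n0 good {gE} => N n0 good.
have a0 : 0 < 4 + N * theta by rewrite addr_gt0 // mulr_gt0.
set r := 1 + theta * (N * z) * (1 - z); have r0 : 0 <= r.
  by rewrite addr_ge0 // !mulr_ge0 ?subr_ge0 // ltW.
set s := Num.sqrt r; have s0 : 0 <= s by exact: sqrtr_ge0.
have s2 : s ^+ 2 = r by exact: sqr_sqrtr.
(* Completing the square after multiplying [Q] by its leading coefficient [4 + N * theta]; the
   squared term on the left is half the derivative of [Q] in [mu]. *)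
have key : ((4 + N * theta) * (mu - z) - 3 * (1 - 2 * z)) ^+ 2 < (3 * s) ^+ 2.
  rewrite exprMn s2 /r -subr_gt0.
  have -> : 3 ^+ 2 * (1 + theta * (N * z) * (1 - z)) -
      ((4 + N * theta) * (mu - z) - 3 * (1 - 2 * z)) ^+ 2 =
    (4 + N * theta) * ((2 * mu + z) * (3 - 2 * mu - z) - N * theta * (z - mu) ^+ 2).
    ring.
  by rewrite mulr_gt0 ?subr_gt0.
have : `|(4 + N * theta) * (mu - z) - 3 * (1 - 2 * z)| < 3 * s.
  by rewrite -(ltr_pXn2r (n := 2)) ?nnegrE ?mulr_ge0 // real_normK ?num_real.
rewrite ltr_norml => /andP[lo hi].
have e t : 3 / (4 + N * theta) * t = 3 * t / (4 + N * theta) by rewrite mulrAC.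
apply/andP; split.
  by rewrite -ltrBrDl e ltr_pdivrMr //; lra.
by rewrite -ltrBlDl e ltr_pdivlMr //; lra.
Qed.

(** This is [Q(mu) >= 0], with equality included because the confidence interval is open. Being
    boolean, it allows extremal sizes to be extracted. *)
Definition uncovered (R : realType) (theta mu : R) (gamma n : nat) : bool :=
  let z := gamma%:R / n%:R in
  (2 * mu + z) * (3 - 2 * mu - z) <= n%:R * theta * (z - mu) ^+ 2.

Section Cutoffs.
Context (R : realType) d (T : measurableType d) (P : probability T R)
  (mu : R) (X : nat -> {RV P >-> bool}) (gamma : nat) (delta : R).
Let theta := 9 / (2 * ln (2 / delta)).
Hypotheses (mu01 : 0 < mu < 1) (iidX : iid_bernoulli P mu X).
Hypotheses (gamma_gt0 : (0 < gamma)%N) (delta01 : 0 < delta < 1).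

Lemma theta_gt0 : 0 < theta.
Proof.
have /andP[d0 d1] := delta01.
rewrite divr_gt0 // mulr_gt0 // ln_gt0 // ltr_pdivlMr //; lra.
Qed.

Lemma early_cutoff : exists n1,
  (P [set w | (gamma <= sample_sum (X^~ w) n1)%N] <= (delta / 2)%:E)%E /\
  forall n, (gamma <= n)%N -> mu < gamma%:R / n%:R ->
    uncovered theta mu gamma n -> (n <= n1)%N.
Proof.
have /andP[mu0 mu1] := mu01.
pose early n :=
  [&& (gamma <= n)%N, mu < gamma%:R / n%:R & uncovered theta mu gamma n].
(* Without any early size the cutoff is 0, since an empty sum never reaches a positive threshold. *)
have [[n en]|none] := pselect (exists n, early n); last first.
  exists 0%N; split.
    have -> : [set w | (gamma <= sample_sum (X^~ w) 0)%N] = set0.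
      by apply/seteqP; split => w //=; rewrite sample_sum0 leqNgt gamma_gt0.
    by rewrite measure0 lee_fin divr_ge0 //; case/andP: delta01 => /ltW.
  by move=> n gn zn bn; exfalso; apply: none; exists n; apply/and3P.
(* [mu < gamma / k] means [k < gamma / mu], so a largest early size exists. *)
have bound k : early k -> (k <= Num.bound (gamma%:R / mu))%N.
  move=> /and3P[gk zk _]; rewrite -(ler_nat R) ltW //.
  have k0 : 0 < k%:R :> R by rewrite ltr0n (leq_trans gamma_gt0 gk).
  apply: le_lt_trans (archi_boundP _); last by apply: divr_ge0 => //; exact: ltW.
  by rewrite ler_pdivlMr // mulrC -ler_pdivlMr // ltW.
have [n1 /and3P[g1 z1 b1] max1] := ex_maxnP (ex_intro _ n en) bound.
exists n1; split; last by move=> k gk zk bk; apply: max1; apply/and3P.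
by apply: (upper_tail_le mu01 iidX delta01 _ b1 (ltW z1)); rewrite gamma_gt0.
Qed.

Lemma late_cutoff : exists m,
  (P [set w | (sample_sum (X^~ w) m < gamma)%N] <= (delta / 2)%:E)%E /\
  forall n, (gamma <= n)%N -> gamma%:R / n%:R < mu ->
    uncovered theta mu gamma n -> (m < n)%N.
Proof.
have /andP[mu0 mu1] := mu01; have th0 := theta_gt0.
pose late n :=
  [&& (gamma <= n)%N, gamma%:R / n%:R < mu & uncovered theta mu gamma n].
have ex : exists n, late n.
  (* The first summand forces [z < mu / 4], hence [(z - mu) ^+ 2 >= 9/16 * mu ^+ 2]; the second
     forces [n * theta * mu ^+ 2 > 36]. The right side of [uncovered] then exceeds 81/4, while the
     left, a product of two numbers with sum 3, is at most 9/4. *)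
  pose B := 4 * gamma%:R / mu + 36 / (theta * mu ^+ 2).
  have B1 : 0 <= 4 * gamma%:R / mu by rewrite !mulr_ge0 ?invr_ge0 // ltW.
  have B2 : 0 <= 36 / (theta * mu ^+ 2).
    by rewrite divr_ge0 // mulr_ge0 ?sqr_ge0 // ltW.
  exists (Num.bound B); have := archi_boundP (addr_ge0 B1 B2).
  rewrite -/B; move: (Num.bound B) => n Bn.
  have g0 : 0 < gamma%:R :> R by rewrite ltr0n.
  have n1 : 4 * gamma%:R < n%:R * mu.
    by rewrite -ltr_pdivrMr //; apply: le_lt_trans Bn; rewrite lerDl.
  have n2 : 36 < n%:R * theta * mu ^+ 2.
    rewrite -mulrA -ltr_pdivrMr ?(mulr_gt0 th0) ?exprn_gt0 //.
    by apply: le_lt_trans Bn; rewrite lerDr.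
  have gn : gamma%:R <= n%:R :> R by nra.
  have n0 : 0 < n%:R :> R by exact: lt_le_trans gn.
  have z4 : gamma%:R / n%:R < mu / 4 by rewrite ltr_pdivrMr //; lra.
  have z0 : 0 < gamma%:R / n%:R :> R by exact: divr_gt0.
  rewrite /late -(ler_nat R) gn /uncovered /=.
  move: (gamma%:R / n%:R) z4 z0 => z z4 z0; apply/andP; split; first lra.
  have t0 : 0 < n%:R * theta by exact: mulr_gt0.
  have zm : 9 / 16 * mu ^+ 2 <= (z - mu) ^+ 2 by nra.
  have := ler_wpM2l (ltW t0) zm.
  nra.
have [n /and3P[gn zn bn] nmin] := ex_minnP ex.
have n0 : (0 < n)%N by exact: leq_trans gn.
(* Stopping no earlier than [n] means that the first [n.-1] samples miss the threshold. *)
exists n.-1; split; last first.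
  by move=> k gk zk bk; rewrite prednK //; apply: nmin; apply/and3P.
by apply: (lower_tail_le mu01 iidX delta01 _ bn (ltW zn)); rewrite gamma_gt0.
Qed.
End Cutoffs.

Theorem theorem4 (R : realType) (d : measure_display) (T : measurableType d)
    (P : probability T R) (mu : R) (X : nat -> {RV P >-> bool})
    (gamma : nat) (delta : R)
    (mu01 : 0 < mu < 1)
    (iidX : iid_bernoulli P mu X)
    (gamma_gt0 : (0 < gamma)%N)
    (delta01 : 0 < delta < 1) :
  let theta := 9 / (2 * ln (2 / delta)) in
  let n := fun w : T => stopping_size gamma (fun i => X i w) in
  ((1 - delta)%:E <=
   P [set w | (ci_lower theta gamma (n w) < mu < ci_upper theta gamma (n w))%R])%E.
Proof.
pose theta : R := 9 / (2 * ln (2 / delta)).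
pose n (w : T) := stopping_size gamma (X^~ w).
change ((1 - delta)%:E <=
  P [set w | (ci_lower theta gamma (n w) < mu < ci_upper theta gamma (n w))%R])%E.
have th0 : 0 < theta := theta_gt0 delta01.
have [n1 [PA early]] := early_cutoff mu01 iidX gamma_gt0 delta01.
have [m [PB late]] := late_cutoff mu01 iidX gamma_gt0 delta01.
set A := [set w | (gamma <= _)%N] in PA; set B := [set w | (_ < gamma)%N] in PB.
have mA : measurable A by exact: (measurable_sample_sum X n1 (leq gamma)).
have mB : measurable B by exact: (measurable_sample_sum X m (ltn^~ gamma)).
have mAB : measurable (A `|` B) by exact: measurableU.
have mG : measurable
    [set w | (ci_lower theta gamma (n w) < mu < ci_upper theta gamma (n w))%R].
  exact: (measurable_stopping_size X
    [set k | ci_lower theta gamma k < mu < ci_upper theta gamma k] gamma_gt0).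
(* Outside [A] and [B], sampling stops after [n1] and no later than [m], and coverage holds for
   every such size. *)
apply: (@le_trans _ _ (P (~` (A `|` B)))); last first.
  apply: le_measure; rewrite ?inE //; first exact: measurableC.
  move=> w /= /not_orP[/negP nA /negP nB].
  rewrite -ltnNge in nA; rewrite -leqNgt in nB.
  have [n0 gS nmin] := stopping_size_spec gamma_gt0 nB.
  have m0 : (0 < m)%N.
    by case: m nB {late PB B mB mAB nmin} => //; rewrite sample_sum0 leqNgt gamma_gt0.
  have nm := nmin _ m0 nB; rewrite -/(n w) in n0 gS nm.
  have gn : (gamma <= n w)%N := leq_trans gS (sample_sum_le _ _).
  apply: ci_of_quadratic; rewrite ?gamma_gt0 // ltNge; apply/negP => bad.
  have [zmu|muz|zE] := ltgtP (gamma%:R / (n w)%:R) mu.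
  - by have := late _ gn zmu bad; rewrite ltnNge nm.
  - have := leq_trans gS (sample_sum_homo _ (early _ gn muz bad)).
    by rewrite leqNgt nA.
  (* At [z = mu] the right side of [bad] is 0 and the left is [9 * mu * (1 - mu) > 0]. *)
  - move: bad mu01; rewrite zE subrr expr0n mulr0; nra.
rewrite probability_setC // EFinB leeB //.
apply: le_trans (measureU2 P mA mB) _.
by rewrite [delta]splitr EFinD leeD.
Qed.
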